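(* Consider the higher order Camassa–Holm equation $\Delta[u]=0$, where $$\Delta[u]=u_t-u_{xxt}+u_{xxxxt}+3uu_x-2u_xu_{xx}-uu_{xxx}+2u_xu_{xxxx}+uu_{xxxxx}.$$ The multipliers $\xi=1$ and $\xi=u$ yield, respectively, the following two local conservation laws of this equation: in each case the left-hand side below equals $\xi\,\Delta[u]$ identically for arbitrary functions $u(x,t)$, and hence vanishes for every solution $u$ of $\Delta[u]=0$. (1) For $\xi=1$: $$D_x\Big(\tfrac32u^2-\tfrac12u_x^2-\tfrac23u_{xt}-uu_{xx}+u_xu_{xxx}-\tfrac12u_{xx}^2+\tfrac45u_{xxxt}+uu_{xxxx}\Big)+D_t\Big(u-\tfrac13u_{xx}+\tfrac15u_{xxxx}\Big)=0.$$ (2) For $\xi=u$: $$D_x\Big(u^3+u^2u_{xxxx}-\tfrac23uu_{xt}+\tfrac13u_xu_t-u^2u_{xx}+\tfrac45uu_{xxxt}-\tfrac15u_{xxx}u_t-\tfrac35u_xu_{xxt}+\tfrac25u_{xx}u_{xt}\Big)$$ $$+D_t\Big(\tfrac12u^2-\tfrac13uu_{xx}+\tfrac16u_x^2+\tfrac15uu_{xxxx}-\tfrac15u_xu_{xxx}+\tfrac1{10}u_{xx}^2\Big)=0.$$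
   Context: $u(x,t)$ is a smooth real function of two real variables, subscripts denote partial derivatives, and $D_x,D_t$ denote total derivatives with respect to $x$ and $t$. A local conservation law of the equation $\Delta[u]=0$ with multiplier $\xi$ is an expression $D_t\Psi+D_x\Phi$, with $\Psi,\Phi$ functions of $x,t,u$ and finitely many derivatives of $u$, such that $D_t\Psi+D_x\Phi\equiv\xi\,\Delta[u]$ identically for arbitrary $u(x,t)$, so that $D_t\Psi+D_x\Phi=0$ on all solutions of $\Delta[u]=0$. *)

(* Defs.v *)
From Stdlib Require Import Reals.
From Coquelicot Require Import Coquelicot.
Open Scope R_scope.

Definition smooth (u : R -> R -> R) : Prop :=
  forall (n : nat) (x t : R), ex_diff_n u n x t.

(* Jet coordinates: [w.[i, j]] stands for u differentiated i times in x and
   j times in t, so [w.[0, 0]] is u and [w.[3, 1]] is u_{xxxt}. *)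
Definition jet : Type := nat -> nat -> R.

Notation "w .[ i , j ]" := ((w : jet) i%nat j%nat)
  (at level 2, left associativity, format "w .[ i ,  j ]") : R_scope.

Definition jet_of (u : R -> R -> R) (x t : R) : jet :=
  fun i j => partial_derive i j u x t.

(* A function of x, t, u and derivatives of u; [finite_order] says that only
   finitely many derivatives actually occur. *)
Definition diff_fun : Type := R -> R -> jet -> R.

Definition finite_order (F : diff_fun) : Prop :=
  exists n : nat, forall (x t : R) (w w' : jet),
    (forall i j : nat, (i + j <= n)%nat -> w.[i, j] = w'.[i, j]) ->
    F x t w = F x t w'.

Definition eval (F : diff_fun) (u : R -> R -> R) (x t : R) : R :=
  F x t (jet_of u x t).

(* [total_Dx F u] and [total_Dt F u] are the total derivatives of F along u: F is
   differentiated after u(x,t) and its derivatives have been substituted. *)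
Definition total_Dx (F : diff_fun) (u : R -> R -> R) (x t : R) : R :=
  Derive (fun y => eval F u y t) x.

Definition total_Dt (F : diff_fun) (u : R -> R -> R) (x t : R) : R :=
  Derive (fun s => eval F u x s) t.

Definition is_solution (Delta : diff_fun) (u : R -> R -> R) : Prop :=
  forall x t : R, eval Delta u x t = 0.

(* The two [ex_derive] conditions are there because [Derive] is total: they
   ensure that [total_Dt Psi u] and [total_Dx Phi u] are genuine derivatives. *)
Definition local_conservation_law (Delta xi Psi Phi : diff_fun) : Prop :=
  finite_order Psi /\ finite_order Phi /\
  forall u : R -> R -> R, smooth u -> forall x t : R,
    ex_derive (fun s => eval Psi u x s) t /\
    ex_derive (fun y => eval Phi u y t) x /\
    total_Dt Psi u x t + total_Dx Phi u x t = eval xi u x t * eval Delta u x t.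

Definition vanishes_on_solutions (Delta Psi Phi : diff_fun) : Prop :=
  forall u : R -> R -> R, smooth u -> is_solution Delta u ->
  forall x t : R, total_Dt Psi u x t + total_Dx Phi u x t = 0.

Definition CH_Delta : diff_fun := fun _ _ w =>
  w.[0,1] - w.[2,1] + w.[4,1] + 3 * w.[0,0] * w.[1,0]
  - 2 * w.[1,0] * w.[2,0] - w.[0,0] * w.[3,0]
  + 2 * w.[1,0] * w.[4,0] + w.[0,0] * w.[5,0].

Definition xi_1 : diff_fun := fun _ _ _ => 1.

Definition Phi_1 : diff_fun := fun _ _ w =>
  3/2 * w.[0,0] ^ 2 - 1/2 * w.[1,0] ^ 2 - 2/3 * w.[1,1]
  - w.[0,0] * w.[2,0] + w.[1,0] * w.[3,0] - 1/2 * w.[2,0] ^ 2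
  + 4/5 * w.[3,1] + w.[0,0] * w.[4,0].

Definition Psi_1 : diff_fun := fun _ _ w =>
  w.[0,0] - 1/3 * w.[2,0] + 1/5 * w.[4,0].

Definition xi_u : diff_fun := fun _ _ w => w.[0,0].

Definition Phi_u : diff_fun := fun _ _ w =>
  w.[0,0] ^ 3 + w.[0,0] ^ 2 * w.[4,0] - 2/3 * w.[0,0] * w.[1,1]
  + 1/3 * w.[1,0] * w.[0,1] - w.[0,0] ^ 2 * w.[2,0]
  + 4/5 * w.[0,0] * w.[3,1] - 1/5 * w.[3,0] * w.[0,1]
  - 3/5 * w.[1,0] * w.[2,1] + 2/5 * w.[2,0] * w.[1,1].

Definition Psi_u : diff_fun := fun _ _ w =>
  1/2 * w.[0,0] ^ 2 - 1/3 * w.[0,0] * w.[2,0] + 1/6 * w.[1,0] ^ 2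
  + 1/5 * w.[0,0] * w.[4,0] - 1/5 * w.[1,0] * w.[3,0]
  + 1/10 * w.[2,0] ^ 2.

(* Main.v *)
(** Along a smooth [u], the jet coordinates satisfy [D_x w_(i,j) = w_(i+1,j)]
    and, by the symmetry of mixed partials, [D_t w_(i,j) = w_(i,j+1)].  The
    product rule then turns each conservation law into a polynomial identity
    between jet coordinates. *)

Require Import Defs.
From Stdlib Require Import Reals Lia.
From Coquelicot Require Import Coquelicot.

Lemma is_derive_jet_x (u : R -> R -> R) (i j : nat) (x t : R) :
  smooth u ->
  is_derive (fun y => (jet_of u y t).[i, j]) x (jet_of u x t).[S i, j].
Proof.
intros Hu.
apply (Derive_correct (fun y => (jet_of u y t).[i, j])).
apply ex_diff_n_ex_deriv_inf_1 with (n := S (i + j)); [lia | apply Hu].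
Qed.

(** [partial_derive] applies the t-derivatives first, so the x-version holds by unfolding, whereas
    here the new t-derivative must be commuted past [i] x-derivatives by Schwarz's theorem. *)
Lemma is_derive_jet_t (u : R -> R -> R) (i j : nat) (x t : R) :
  smooth u ->
  is_derive (fun s => (jet_of u x s).[i, j]) t (jet_of u x t).[i, S j].
Proof.
intros Hu.
unfold jet_of at 2.
rewrite <- Derive_partial_derive.
- apply (Derive_correct (fun s => partial_derive i j u x s)).
  apply ex_diff_n_ex_deriv_inf_2 with (n := S (i + j)); [lia | apply Hu].
- apply locally_2d_forall; intros; apply Hu.
Qed.

(* The families [g] and [h] are the jets of a function along the vertical and
   the horizontal line through (x, t); [u] itself no longer occurs, and
   [auto_derive] can treat each [g i j] and [h i j] as an unknown function. *)
Lemma local_conservation_law_of_jets (Delta xi Psi Phi : diff_fun) :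
  finite_order Psi -> finite_order Phi ->
  (forall (x t : R) (w : jet) (g h : nat -> nat -> R -> R),
     (forall i j, g i j t = w.[i, j]) ->
     (forall i j, h i j x = w.[i, j]) ->
     (forall i j, is_derive (g i j) t w.[i, S j]) ->
     (forall i j, is_derive (h i j) x w.[S i, j]) ->
     exists dPsi dPhi : R,
       is_derive (fun s => Psi x s (fun i j => g i j s)) t dPsi /\
       is_derive (fun y => Phi y t (fun i j => h i j y)) x dPhi /\
       dPsi + dPhi = xi x t w * Delta x t w) ->
  local_conservation_law Delta xi Psi Phi.
Proof.
intros HPsi HPhi H.
split; [exact HPsi | split; [exact HPhi |]].
intros u Hu x t.
destruct (H x t (jet_of u x t) (fun i j s => (jet_of u x s).[i, j])
            (fun i j y => (jet_of u y t).[i, j]))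
  as (dPsi & dPhi & DPsi & DPhi & E); try reflexivity.
- intros i j; apply is_derive_jet_t, Hu.
- intros i j; apply is_derive_jet_x, Hu.
- split; [exists dPsi; exact DPsi | split; [exists dPhi; exact DPhi |]].
  replace (total_Dt Psi u x t) with dPsi
    by (symmetry; apply is_derive_unique, DPsi).
  replace (total_Dx Phi u x t) with dPhi
    by (symmetry; apply is_derive_unique, DPhi).
  exact E.
Qed.

Lemma local_conservation_law_vanishes (Delta xi Psi Phi : diff_fun) :
  local_conservation_law Delta xi Psi Phi ->
  vanishes_on_solutions Delta Psi Phi.
Proof.
intros (_ & _ & H) u Hu Hsol x t.
destruct (H u Hu x t) as (_ & _ & ->).
rewrite (Hsol x t); apply Rmult_0_r.
Qed.

(** The order 4 is attained by [w.[4,0]] and [w.[3,1]]. *)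
Ltac prove_finite_order F :=
  exists 4%nat; intros x t w w' Hw; unfold F;
  rewrite ?(fun i j => Hw i j) by lia; reflexivity.

Ltac prove_jet_identity Psi Phi xi :=
  intros x t w g h Eg Eh Dg Dh;
  (* The two derivatives stay open until [auto_derive] has computed them and [reflexivity] fixes
     them. *)
  do 2 eexists; split; [| split];
  [ unfold Psi; auto_derive; [repeat split; eexists; apply Dg | reflexivity]
  | unfold Phi; auto_derive; [repeat split; eexists; apply Dh | reflexivity]
  | rewrite ?(fun i j => is_derive_unique _ _ _ (Dg i j)),
      ?(fun i j => is_derive_unique _ _ _ (Dh i j)), ?Eg, ?Eh;
    unfold xi, CH_Delta; field ].

(** The mixed terms of [CH_Delta] are shared between $D_t\Psi$ and $D_x\Phi$: $u_{xxt}$ as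
    $-\frac13-\frac23$, $u_{xxxxt}$ as $\frac15+\frac45$. *)
Lemma CH_conservation_law_1 : local_conservation_law CH_Delta xi_1 Psi_1 Phi_1.
Proof.
apply local_conservation_law_of_jets.
- prove_finite_order Psi_1.
- prove_finite_order Phi_1.
- prove_jet_identity Psi_1 Phi_1 xi_1.
Qed.

(** The same shares serve for $uu_{xxt}$ and $uu_{xxxxt}$; the leftover products such as $u_tu_{xx}$
    and $u_xu_{xxxt}$ cancel between $D_t\Psi$ and $D_x\Phi$. *)
Lemma CH_conservation_law_u : local_conservation_law CH_Delta xi_u Psi_u Phi_u.
Proof.
apply local_conservation_law_of_jets.
- prove_finite_order Psi_u.
- prove_finite_order Phi_u.
- prove_jet_identity Psi_u Phi_u xi_u.
Qed.

Theorem mainTheorem5 :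
  (local_conservation_law CH_Delta xi_1 Psi_1 Phi_1 /\
   vanishes_on_solutions CH_Delta Psi_1 Phi_1) /\
  (local_conservation_law CH_Delta xi_u Psi_u Phi_u /\
   vanishes_on_solutions CH_Delta Psi_u Phi_u).
Proof.
split; split.
- apply CH_conservation_law_1.
- apply local_conservation_law_vanishes with xi_1, CH_conservation_law_1.
- apply CH_conservation_law_u.
- apply local_conservation_law_vanishes with xi_u, CH_conservation_law_u.
Qed.
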